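(* Let $n\ge 3$, $\alpha\in(0,n)$, $p,q>0$ with $pq>1$ and $p\le q$. Let $u,v$ be positive solutions on $\mathbb{R}^n$ of the system $$u(x)=\int_{\mathbb{R}^n}\frac{v^q(y)\,dy}{|x-y|^{n-\alpha}},\qquad v(x)=\int_{\mathbb{R}^n}\frac{u^p(y)\,dy}{|x-y|^{n-\alpha}}.$$ Then there exists $c>0$ such that for all sufficiently large $|x|$, $$u(x)\ge \frac{c}{|x|^{n-\alpha}},\qquad v(x)\ge \frac{c}{|x|^{\min\{n-\alpha,\;pn-(p+1)\alpha\}}}.$$ Moreover, if $u,v$ are bounded and tend to $0$ as $|x|\to\infty$, and there exists $\epsilon_0>0$ such that either $u(y)\ge \epsilon_0 u(x)$ for all $x,y$ with $|y|\le |x|$, or $v(y)\ge\epsilon_0 v(x)$ for all $x,y$ with $|y|\le|x|$, then there exists $C>0$ such that for all sufficiently large $|x|$, $$u(x)\le C|x|^{-\frac{\alpha(q+1)}{pq-1}},\qquad v(x)\le C|x|^{-\frac{\alpha(p+1)}{pq-1}}.$$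
   Context: A pair of positive solutions means positive measurable functions $u,v$ on $\mathbb{R}^n$ for which both integral identities hold (with finite values) at every $x\in\mathbb{R}^n$. *)

(* Defs.v *)
From HB Require Import structures.
From mathcomp Require Import all_boot all_order all_algebra.
From mathcomp Require Import all_classical all_reals all_analysis.
Set Implicit Arguments. Unset Strict Implicit. Unset Printing Implicit Defensive.
Import Order.TTheory GRing.Theory Num.Theory.
Import numFieldNormedType.Exports.
Local Open Scope classical_set_scope.
Local Open Scope ring_scope.

(* Euclidean norm on R^n (MathComp's `|.| on matrices is the sup norm). *)
Definition enorm (R : realType) (n : nat) (x : 'rV[R]_n) : R :=
  Num.sqrt (\sum_(i < n) x ord0 i ^+ 2).

Definition borelRn (R : realType) (n : nat) : set (set 'rV[R]_n) :=
  <<s [set O | @open ('rV[R]_n : topologicalType) O] >>.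

Definition borel_measurable (R : realType) (n : nat) (f : 'rV[R]_n -> R) :=
  forall B : set R, measurable B -> borelRn (f @^-1` B).

(* Lebesgue integral over R^n of a nonnegative function, computed as the
   iterated one-dimensional Lebesgue integral (equal to the integral w.r.t.
   n-dimensional Lebesgue measure for nonnegative Borel functions, Tonelli). *)
Fixpoint intRn (R : realType) (n : nat) : ('rV[R]_n -> \bar R) -> \bar R :=
  match n with
  | 0 => fun f => f 0
  | m.+1 => fun f =>
      (\int[@lebesgue_measure R]_t
         intRn (fun y : 'rV[R]_m => f (row_mx (\row_(j < 1) t) y)))%E
  end.

Definition riesz (R : realType) (n : nat) (alpha : R) (g : 'rV[R]_n -> R)
    (x : 'rV[R]_n) : \bar R :=
  intRn (fun y => (g y / (enorm (x - y) `^ (n%:R - alpha)))%:E).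

(* Main.v *)
Require Import Defs.
From HB Require Import structures.
From mathcomp Require Import all_boot all_order all_algebra.
From mathcomp Require Import all_classical all_reals all_analysis.
From mathcomp Require Import measurable_realfun.
From mathcomp Require Import ring lra.
Import Order.TTheory GRing.Theory Num.Theory.
Import numFieldNormedType.Exports.
Local Open Scope classical_set_scope.
Local Open Scope ring_scope.

(** Write [s = n - alpha], [a = alpha (q + 1) / (p q - 1)], [b = alpha (p + 1) / (p q - 1)];
    the kernel is [|x - y|^-s].

    Lower bounds.  For [|x| > 1] and [|y| <= 1] one has [|x - y| <= 2 |x|], so both
    potentials are at least a constant times [|x|^-s]; inserting this bound for [u]
    into the part of the integral of [u^p] near [x] gives the second rate for [v].

    Upper bounds.  Let [u] be almost decreasing (the other case is symmetric).
    Integrating over a cube of size [|x|] inside the ball of radius [|x|] gives [v >= c u^p |x|^alpha], and once more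
    [u >= c u^(p q) |x|^(alpha q + alpha)], hence the decay [u <= C |x|^-a].  For [v],
    splitting the integral at distance comparable to [|x|] from [x] gives the
    Harnack-type inequality [v x <= C v z + D |x|^-b] for [z] near [x], where the local
    part is controlled by the decay of [u].  If [v x] is not already [O(|x|^-b)], then
    [v z >= v x / 2C] on a cube near [x], so [u x >= c (v x)^q |x|^alpha], and the decay
    of [u] bounds [v x].  No integration at infinity is needed, which avoids the
    critical case [p a = n]. *)

(** * Euclidean norm: Cauchy-Schwarz, triangle inequality, comparison with coordinates *)

Section EuclideanNorm.
Context {R : realType} {n : nat}.
Implicit Types (x y : 'rV[R]_n) (a : R).

Lemma enorm_ge0 x : 0 <= enorm x. Proof. exact: sqrtr_ge0. Qed.

Lemma enorm_sqr x : enorm x ^+ 2 = \sum_(i < n) x ord0 i ^+ 2.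
Proof. by rewrite sqr_sqrtr// sumr_ge0// => i _; rewrite sqr_ge0. Qed.

Lemma enormZ a x : enorm (a *: x) = `|a| * enorm x.
Proof.
apply/eqP; rewrite -(eqrXn2 (ltn0Sn 1)) ?mulr_ge0 ?enorm_ge0//.
rewrite exprMn !enorm_sqr real_normK ?num_real// mulr_sumr; apply/eqP.
by apply: eq_bigr => i _; rewrite mxE exprMn.
Qed.

Lemma enormN x : enorm (- x) = enorm x.
Proof. by rewrite -scaleN1r enormZ normrN1 mul1r. Qed.

Lemma enormBC x y : enorm (x - y) = enorm (y - x).
Proof. by rewrite -enormN opprB. Qed.

(* Expand [sum_i (|y| x_i - |x| y_i)^2 >= 0]. *)
Lemma enorm_cauchy_schwarz x y :
  \sum_(i < n) x ord0 i * y ord0 i <= enorm x * enorm y.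
Proof.
have [|x0] := boolP (0 < enorm x * enorm y); last first.
  have : enorm x * enorm y = 0.
    by apply/eqP; rewrite eq_le mulr_ge0 ?enorm_ge0// andbT leNgt.
  move=> /[dup] xy0 -> {x0}.
  move/eqP : xy0; rewrite mulf_eq0 => /orP[] /eqP /(congr1 (fun t => t ^+ 2));
    rewrite enorm_sqr expr0n/= => /eqP; rewrite psumr_eq0; last first.
  - by move=> i _; exact: sqr_ge0.
  - move=> /allP y0; rewrite big1// => i _.
    by have := y0 i (mem_index_enum _); rewrite /= sqrf_eq0 => /eqP ->; rewrite mulr0.
  - by move=> i _; exact: sqr_ge0.
  - move=> /allP y0; rewrite big1// => i _.
    by have := y0 i (mem_index_enum _); rewrite /= sqrf_eq0 => /eqP ->; rewrite mul0r.
set a := enorm x; set b := enorm y => ab0.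
have : 0 <= \sum_(i < n) (b * x ord0 i - a * y ord0 i) ^+ 2.
  by apply: sumr_ge0 => i _; exact: sqr_ge0.
have -> : \sum_(i < n) (b * x ord0 i - a * y ord0 i) ^+ 2 =
    b ^+ 2 * (\sum_(i < n) x ord0 i ^+ 2) + a ^+ 2 * (\sum_(i < n) y ord0 i ^+ 2)
    - 2 * (a * b) * (\sum_(i < n) x ord0 i * y ord0 i).
  rewrite !mulr_sumr -sumrN -!big_split/=; apply: eq_bigr => i _; ring.
rewrite -!enorm_sqr -/a -/b.
set S := \sum_(_ < _) _ => H.
have {}H : 0 <= 2 * (a * b) * (a * b - S).
  by apply: le_trans H _; rewrite le_eqVlt; apply/orP; left; apply/eqP; ring.
by rewrite -subr_ge0 -(pmulr_rge0 _ (_ : 0 < 2 * (a * b)))// mulr_gt0.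
Qed.

Lemma enormD x y : enorm (x + y) <= enorm x + enorm y.
Proof.
rewrite -(@ler_pXn2r _ 2)// ?nnegrE ?addr_ge0 ?enorm_ge0//.
rewrite sqrrD !enorm_sqr.
have -> : \sum_(i < n) (x + y) ord0 i ^+ 2 = \sum_(i < n) x ord0 i ^+ 2 +
    (\sum_(i < n) x ord0 i * y ord0 i) *+ 2 + \sum_(i < n) y ord0 i ^+ 2.
  rewrite -sumrMnl -!big_split/=; apply: eq_bigr => i _.
  by rewrite mxE sqrrD.
by rewrite lerD2r lerD2l lerMn2r/= enorm_cauchy_schwarz.
Qed.

Lemma enormB x y : enorm (x - y) <= enorm x + enorm y.
Proof. by rewrite -[enorm y]enormN enormD. Qed.

Lemma enorm_coord x i : `|x ord0 i| <= enorm x.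
Proof.
rewrite -(@ler_pXn2r _ 2)// ?nnegrE ?enorm_ge0// enorm_sqr real_normK ?num_real//.
by rewrite (bigD1 i)//= lerDl sumr_ge0// => j _; exact: sqr_ge0.
Qed.

Lemma enorm_eq0 x : (enorm x == 0) = (x == 0).
Proof.
apply/eqP/eqP => [x0|->]; last first.
  by rewrite /enorm big1 ?sqrtr0// => i _; rewrite mxE expr0n.
apply/rowP => i; rewrite mxE; apply/eqP; rewrite -normr_eq0 eq_le normr_ge0.
by rewrite -x0 enorm_coord.
Qed.

(** The crude factor [n] replaces the sharp square root of [n]; the half-sides of the cubes used
    later are divided by [n] to compensate. *)
Lemma enorm_le_bound x r : 0 <= r -> (forall i, `|x ord0 i| <= r) ->
  enorm x <= n%:R * r.
Proof.
move=> r0 xr; rewrite -(@ler_pXn2r _ 2)// ?nnegrE ?mulr_ge0 ?enorm_ge0//.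
rewrite enorm_sqr; apply: (@le_trans _ _ (\sum_(i < n) r ^+ 2)).
  apply: ler_sum => i _; rewrite -(real_normK (num_real (x ord0 i))).
  by rewrite ler_pXn2r// nnegrE.
rewrite sumr_const card_ord exprMn -[_ *+ n]mulr_natl.
apply: ler_wpM2r; first exact: sqr_ge0.
by rewrite -natrX ler_nat; case: (n) => // m; rewrite leq_pmulr.
Qed.

End EuclideanNorm.

(** Row vectors with the sigma-algebra [borelRn], so that [borel_measurable] becomes an instance of
    [measurable_fun]. *)
Notation Rn R n := (g_sigma_algebraType [set O | @open ('rV[R]_n : topologicalType) O]).

(** * Borel structure of the space of row vectors and measurable cubes *)

Section BorelSpace.
Context {R : realType}.

(** Rational vectors are dense, so countably many sup-norm balls recover any open set; this is what
    reduces measurability to coordinates. *)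
Lemma open_bigcup_rat_ball {n} (O : set 'rV[R]_n) : open O ->
  O = \bigcup_(qk in [set qk : 'rV[rat]_n * nat |
    ball (map_mx ratr qk.1 : 'rV[R]_n) (qk.2.+1%:R^-1 : R) `<=` O])
    ball (map_mx ratr qk.1 : 'rV[R]_n) (qk.2.+1%:R^-1 : R).
Proof.
move=> oO; apply/seteqP; split=> [y Oy|y [[q k] /= sub]]; last exact: sub.
have /nbhs_ballP[e /= e0 ye] := open_nbhs_nbhs (conj oO Oy).
have [k ke] : exists k : nat, k.+1%:R^-1 < e / 2.
  have /ltr_add_invr[k] : 0 < e / 2 by rewrite divr_gt0.
  by rewrite add0r => ?; exists k.
have hq (i : 'I_n) : exists q : rat, `|y ord0 i - ratr q| < k.+1%:R^-1.
  have [|q] := @rat_in_itvoo R (y ord0 i - k.+1%:R^-1) (y ord0 i + k.+1%:R^-1).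
    by rewrite ltrBlDr -addrA ltrDl addr_gt0// invr_gt0.
  by rewrite in_itv/= => qy; exists q; rewrite distrC ltr_distl.
have [q qP] := @choice _ _ (fun i q => `|y ord0 i - ratr q| < k.+1%:R^-1 :> R) hq.
have yq i : `|y ord0 i - ratr (q i)| < k.+1%:R^-1 := qP i.
exists (\row_i q i, k) => /=.
  move=> z [_ zq]; apply: ye; split=> // i j; rewrite ord1.
  have := zq ord0 j; rewrite /ball/= !mxE => zqj.
  rewrite -(subrKA (ratr (q j))) (le_lt_trans (ler_normD _ _))//.
  rewrite (splitr e) ltrD//; first exact: lt_trans (yq j) ke.
  exact: lt_trans zqj ke.
by split=> [|i j]; [rewrite invr_gt0|rewrite ord1 /ball/= !mxE distrC].
Qed.

Lemma measurable_coord {n} (i : 'I_n) :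
  measurable_fun [set: Rn R n] (fun y : Rn R n => y ord0 i).
Proof.
apply: (measurability (RGenOInfty.G (R := R))).
  exact: RGenOInfty.measurableE.
move=> _ -[_ [x ->] <-]; rewrite setTI; apply: sub_sigma_algebra => /=.
apply: (@open_comp _ _ (fun y : 'rV[R]_n => y ord0 i)) => [y _|].
  exact: coord_continuous.
exact: interval_open.
Qed.

(** An open set is a countable union of sup-norm balls, and the preimage of each ball is a finite
    intersection of conditions on single coordinates. *)
Lemma measurable_rV {n d} {T : measurableType d} (f : T -> Rn R n) :
  (forall i, measurable_fun setT (fun t => f t ord0 i)) -> measurable_fun setT f.
Proof.
move=> mf; apply: (@measurability _ _ _ (Rn R n) setT f [set U | @open ('rV[R]_n : topologicalType) U] erefl).
move=> _ -[U oU <-]; rewrite setTI (open_bigcup_rat_ball _ oU) preimage_bigcup.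
rewrite bigcup_mkcond; apply: countable_bigcupT_measurable => [|[q k]].
  exact: countableP.
case: ifPn => // _; rewrite [X in measurable X](_ : _ = \bigcap_(i in [set: 'I_n])
    ((fun t => f t ord0 i) @^-1` ball (ratr (q ord0 i) : R) (k.+1%:R^-1 : R))); last first.
  apply/seteqP; split=> t /= => [[_ ft] i _|ft].
    by have := ft ord0 i; rewrite mxE.
  split=> [|i j]; first by rewrite invr_gt0.
  by have := ft j I; rewrite (ord1 i) /= mxE.
apply: fin_bigcap_measurable; first exact: finite_finset.
move=> i _; rewrite -[X in measurable X]setTI; apply: mf => //.
exact: measurable_ball.
Qed.

Lemma row_mx0 m (t : R) (y : 'rV[R]_m) :
  row_mx (\row_(j < 1) t) y ord0 ord0 = t.
Proof.
by rewrite (_ : ord0 = lshift m (ord0 : 'I_1)) ?row_mxEl ?mxE//; exact: val_inj.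
Qed.

Lemma row_mxS m (t : R) (y : 'rV[R]_m) (i : 'I_m) :
  row_mx (\row_(j < 1) t) y ord0 (lift ord0 i) = y ord0 i.
Proof.
by rewrite (_ : lift ord0 i = rshift 1 i) ?row_mxEr//; exact: val_inj.
Qed.

Lemma measurable_row_mx m : measurable_fun setT
  (fun z : measurableTypeR R * Rn R m => row_mx (\row_(j < 1) z.1) z.2 : Rn R m.+1).
Proof.
apply: measurable_rV => i; case: (unliftP ord0 i) => [j|] ->.
  apply: (eq_measurable_fun (fun z : measurableTypeR R * Rn R m => z.2 ord0 j)).
    by move=> z _; rewrite /= row_mxS.
  exact: measurableT_comp (measurable_coord j) measurable_snd.
apply: (eq_measurable_fun (fun z : measurableTypeR R * Rn R m => z.1)).
  by move=> z _; rewrite /= row_mx0.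
exact: measurable_fst.
Qed.

(** The open sup-norm ball written coordinatewise, without requiring [0 < r]: for [n = 0] it is the
    whole point space, in agreement with the volume [(2 * r) ^+ 0 = 1]. *)
Definition cube {n} (c : 'rV[R]_n) (r : R) : set (Rn R n) :=
  [set y | forall i, `|c ord0 i - y ord0 i| < r].

Lemma measurable_cube {n} (c : 'rV[R]_n) r : measurable (cube c r).
Proof.
rewrite [X in measurable X](_ : _ = \bigcap_(i in [set: 'I_n])
    ((fun y : Rn R n => y ord0 i) @^-1` ball (c ord0 i) r)); last first.
  by apply/seteqP; split=> y /= cy i; have := cy i; [move=> + _|apply].
apply: fin_bigcap_measurable; first exact: finite_finset.
move=> i _; rewrite -[X in measurable X]setTI; apply: measurable_coord => //.
exact: measurable_ball.
Qed.

Lemma cubeS m (c : 'rV[R]_m.+1) r t (y : 'rV[R]_m) :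
  cube c r (row_mx (\row_(j < 1) t) y) <->
  ball (c ord0 ord0) r t /\ cube (\row_i c ord0 (lift ord0 i)) r y.
Proof.
split=> [cy|[ct cy] i].
  split; first by have := cy ord0; rewrite row_mx0.
  by move=> i; have := cy (lift ord0 i); rewrite row_mxS mxE.
case: (unliftP ord0 i) => [j|] ->; last by rewrite row_mx0.
by have := cy j; rewrite row_mxS mxE.
Qed.

(** * The iterated integral: volume of cubes and representation by a sigma-finite measure *)

Lemma eq_intRn {n} (f g : 'rV[R]_n -> \bar R) : f =1 g -> intRn f = intRn g.
Proof. by move=> /funext ->. Qed.

Lemma intRn_cst0 n : intRn (fun _ : 'rV[R]_n => 0%E) = 0%E.
Proof.
elim: n => [|m IH]//=; rewrite -[RHS](integral0 (@lebesgue_measure R) setT).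
by apply: eq_integral => t _; rewrite IH.
Qed.

Lemma intRn_cube {n} (c : 'rV[R]_n) (r : R) : 0 <= r ->
  intRn (fun y => (\1_(cube c r) y)%:E) = ((2 * r) ^+ n)%:E.
Proof.
move=> r0; elim: n c => [|m IH] c /=.
  by rewrite indicE mem_set// => -[].
(* The slice of the cube at first coordinate [t] is a cube one dimension lower if [t] lies in the
   interval, and empty otherwise. *)
transitivity (\int[@lebesgue_measure R]_t
    (((2 * r) ^+ m)%:E * (\1_(ball (c ord0 ord0) r) t)%:E))%E.
  apply: eq_integral => t _; rewrite indicE.
  have [ct|ct] := pselect (ball (c ord0 ord0) r t).
    rewrite mem_set// mule1 -(IH (\row_i c ord0 (lift ord0 i))).
    apply: eq_intRn => y; rewrite !indicE.
    have [cy|cy] := pselect (cube (\row_i c ord0 (lift ord0 i)) r y).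
      by rewrite !mem_set//; apply/cubeS.
    by rewrite !memNset// => /cubeS[].
  rewrite memNset// mule0 -[RHS](intRn_cst0 m).
  apply: eq_intRn => y; rewrite indicE memNset// => /cubeS[].
  by [].
rewrite ge0_integralZl//=; last 2 first.
- by apply: measurableT_comp => //; exact: measurable_indic (measurable_ball _ _).
- by rewrite lee_fin exprn_ge0// mulr_ge0.
rewrite integral_indic//; last exact: measurable_ball.
rewrite setIT exprSr EFinM mulr_natl.
by congr (_ * _)%E; exact: lebesgue_measure_ball.
Qed.

(** Repackages sigma-finiteness as part of the measure, the form in which the induction on the
    dimension feeds it to Tonelli. *)
Lemma sigma_finite_measureP {d} {T : measurableType d} (mu : {measure set T -> \bar R}) :
  sigma_finite setT mu ->
  exists nu : {sigma_finite_measure set T -> \bar R}, forall A, nu A = mu A.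
Proof.
move=> sf.
pose nu : {sigma_finite_measure set T -> \bar R} := HB.pack (Measure.sort mu)
  (@isSFinite.Build d T R mu (sfinite_measure_sigma_finite sf))
  (@isSigmaFinite.Build d T R mu sf).
by exists nu.
Qed.

(* The measure is the push-forward of (Lebesgue measure) x (measure on R^m) along
   [row_mx]; Tonelli identifies its integral with the iterated one. *)
Lemma intRn_measureE n : exists mu : {sigma_finite_measure set (Rn R n) -> \bar R},
  forall f : Rn R n -> \bar R, measurable_fun setT f -> (forall y, 0 <= f y)%E ->
  intRn f = (\int[mu]_y f y)%E.
Proof.
elim: n => [|m [mu muE]].
  exists (dirac (0 : Rn R 0)) => f mf f0.
  by rewrite integral_dirac// diracT mul1e.
pose phi (z : measurableTypeR R * Rn R m) : Rn R m.+1 := row_mx (\row_(j < 1) z.1) z.2.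
have mphi : measurable_fun setT phi by exact: measurable_row_mx.
pose nu_ := pushforward (@lebesgue_measure R \x mu)%E phi : {measure set (Rn R m.+1) -> \bar R}.
pose nu := nu_ mphi.
have nuE (f : Rn R m.+1 -> \bar R) : measurable_fun setT f -> (forall y, 0 <= f y)%E ->
  intRn f = (\int[nu]_y f y)%E.
  move=> mf f0.
  have mfphi : measurable_fun setT (f \o phi) by exact: measurableT_comp.
  rewrite ge0_integral_pushforward//=.
  rewrite preimage_setT fubini_tonelli1//=.
  apply: eq_integral => t _; rewrite /fubini_F/=; apply: muE => //.
  exact: measurable_fun_pair2 mfphi.
(* The cubes of half-side [k] about the origin exhaust the space, and [intRn_cube] makes their
   measure finite. *)
have sf : sigma_finite setT nu.
  exists (fun k => cube 0 k%:R).
    apply/seteqP; split=> // y _.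
    have [k yk] : exists k : nat, enorm y < k%:R.
      by exists (Num.bound (enorm y)); exact/archi_boundP/enorm_ge0.
    exists k => // i; rewrite mxE sub0r normrN.
    exact: le_lt_trans (enorm_coord _ _) yk.
  move=> k; split; first exact: measurable_cube.
  have mk := measurable_cube 0 (k%:R : R).
  have : intRn (fun y : 'rV[R]_m.+1 => (\1_(cube 0 k%:R) y)%:E) = nu (cube 0 k%:R).
    rewrite nuE; last 2 first.
    - by apply: measurableT_comp => //; exact: measurable_indic.
    - by move=> y; rewrite lee_fin.
    by rewrite integral_indic// setIT.
  by move=> <-; rewrite intRn_cube// ltry.
have [nu' nu'E] := sigma_finite_measureP nu sf.
exists nu' => f mf f0; rewrite nuE//.
by apply: eq_measure_integral => A _ _; exact/esym/nu'E.
Qed.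

(** * Integration rules for [intRn], transferred from the representing measure *)

Section IntRn.
Context {n : nat}.
Implicit Types f g : Rn R n -> \bar R.

Lemma intRn_ge0 f : measurable_fun setT f -> (forall y, 0 <= f y)%E -> (0 <= intRn f)%E.
Proof.
by move=> mf f0; have [mu ->] := intRn_measureE n => //; exact: integral_ge0.
Qed.

Lemma intRn_le f g : measurable_fun setT f -> measurable_fun setT g ->
  (forall y, 0 <= f y)%E -> (forall y, f y <= g y)%E -> (intRn f <= intRn g)%E.
Proof.
move=> mf mg f0 fg; have [mu muE] := intRn_measureE n.
rewrite !muE//; last by move=> y; exact: le_trans (fg y).
exact: ge0_le_integral.
Qed.

Lemma intRnD f g : measurable_fun setT f -> measurable_fun setT g ->
  (forall y, 0 <= f y)%E -> (forall y, 0 <= g y)%E ->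
  intRn (fun y => f y + g y)%E = (intRn f + intRn g)%E.
Proof.
move=> mf mg f0 g0; have [mu muE] := intRn_measureE n.
rewrite !muE//; last by move=> y; exact: adde_ge0.
  exact: ge0_integralD.
exact: emeasurable_funD.
Qed.

Lemma intRnZ (k : R) f : measurable_fun setT f -> (forall y, 0 <= f y)%E -> 0 <= k ->
  intRn (fun y => k%:E * f y)%E = (k%:E * intRn f)%E.
Proof.
move=> mf f0 k0; have [mu muE] := intRn_measureE n.
rewrite !muE//; first exact: ge0_integralZl_EFin.
  exact: measurable_funeM.
by move=> y; rewrite mule_ge0.
Qed.

Lemma intRn_nneseries (f : nat -> Rn R n -> \bar R) :
  (forall k, measurable_fun setT (f k)) -> (forall k y, 0 <= f k y)%E ->
  intRn (fun y => \sum_(0 <= k <oo) f k y)%E = (\sum_(0 <= k <oo) intRn (f k))%E.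
Proof.
move=> mf f0; have [mu muE] := intRn_measureE n.
rewrite muE; last 2 first.
- exact: ge0_emeasurable_sum.
- by move=> y; exact: nneseries_ge0.
by rewrite integral_nneseries//; apply: eq_eseriesr => k _; rewrite muE.
Qed.

(** A nonnegative function with zero integral vanishes almost everywhere, hence so does [g]. It
    serves to show that a positive weight has positive mass on a cube. *)
Lemma intRn_eq0 f g : measurable_fun setT f -> measurable_fun setT g ->
  (forall y, 0 <= f y)%E -> (forall y, 0 <= g y)%E ->
  (forall y, f y = 0 -> g y = 0)%E -> intRn f = 0%E -> intRn g = 0%E.
Proof.
move=> mf mg f0 g0 fg; have [mu muE] := intRn_measureE n.
have absE (h : Rn R n -> \bar R) : (forall y, 0 <= h y)%E ->
    (\int[mu]_y h y = \int[mu]_y `|h y|)%E.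
  by move=> h0; apply: eq_integral => y _; rewrite gee0_abs.
rewrite !muE// (absE f)// (absE g)// => /(ae_eq_integral_abs mu measurableT mf) fae.
apply/(ae_eq_integral_abs mu measurableT mg).
by apply: filterS fae => y fy0 _; exact/fg/fy0.
Qed.

End IntRn.

End BorelSpace.

(** * Inequalities for real powers *)

Section PowR.
Context {R : realType}.
Implicit Types t B a e k N : R.

Lemma powRN_le a t e : 0 < a -> a <= t -> 0 <= e -> t `^ (- e) <= a `^ (- e).
Proof.
move=> a0 ale e0; have t0 : 0 < t by exact: lt_le_trans ale.
rewrite !powRN lef_pV2 ?posrE ?powR_gt0//.
by rewrite ge0_ler_powR// nnegrE ltW.
Qed.

Lemma le_powR_root t B e : 0 < e -> 0 <= t -> t `^ e <= B -> t <= B `^ e^-1.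
Proof.
move=> e0 t0 tB; rewrite -[leLHS](powRr1 t0) -(@divff _ e) ?gt_eqF// powRrM.
have B0 : 0 <= B by apply: le_trans tB; exact: powR_ge0.
by apply: ge0_ler_powR; rewrite ?nnegrE ?powR_ge0 ?invr_ge0 ?(ltW e0).
Qed.

Lemma powR_le_base t B e : 0 <= e -> 0 <= t -> t <= B -> t `^ e <= B `^ e.
Proof.
move=> e0 t0 tB; apply: ge0_ler_powR; rewrite ?nnegrE//.
exact: le_trans tB.
Qed.

Lemma powRDr t a e : 0 < t -> t `^ (a + e) = t `^ a * t `^ e.
Proof. by move=> t0; rewrite powRD// (gt_eqF t0) implybT. Qed.

(** Cancel one factor [t], then take the root of order [e]. It is applied with [e = p * q - 1],
    where superlinearity turns a lower bound into decay. *)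
Lemma superlinear_bound k t N a e : 0 < k -> 0 < t -> 0 < N -> 0 < e ->
  k * t `^ (e + 1) * N `^ a <= t -> t <= k^-1 `^ e^-1 * N `^ (- (a / e)).
Proof.
move=> k0 t0 N0 e0; rewrite powRDr// powRr1 ?(ltW t0)// => H.
have {}H : t `^ e <= k^-1 * N `^ (- a).
  rewrite powRN -invfM -[leRHS]mul1r ler_pdivlMr ?mulr_gt0 ?powR_gt0//.
  rewrite -(ler_pM2r t0) mul1r; apply: le_trans H.
  by rewrite le_eqVlt; apply/orP; left; apply/eqP; ring.
have := le_powR_root _ _ _ e0 (ltW t0) H.
by rewrite powRM ?invr_ge0 ?powR_ge0 ?(ltW k0)// -powRrM mulNr.
Qed.

End PowR.

(** * Estimates for a single Riesz potential *)

Section RieszPotential.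
Context {R : realType} {n : nat} {alpha : R}.
Hypothesis n_gt0 : (0 < n)%N.
Hypothesis alpha_gt0 : 0 < alpha.
Hypothesis alpha_lt : alpha < n%:R.
Implicit Types (x z : 'rV[R]_n) (g : 'rV[R]_n -> R).

Let s := n%:R - alpha.
Let s_gt0 : 0 < s. Proof. by rewrite subr_gt0. Qed.
Let n_gt0' : 0 < n%:R :> R. Proof. by rewrite ltr0n. Qed.

Lemma rieszE g x :
  riesz alpha g x = intRn (fun y => (g y * enorm (x - y) `^ (- s))%:E).
Proof. by apply: eq_intRn => y; rewrite powRN. Qed.

Lemma borel_measurableP g : borel_measurable g <-> measurable_fun setT (g : Rn R n -> R).
Proof.
split=> [mg _ B mB|mg B mB]; first by rewrite setTI; exact: mg.
by rewrite -[_ @^-1` _]setTI; exact: mg.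
Qed.

Lemma measurable_kernel x t :
  measurable_fun setT (fun y : Rn R n => enorm (x - y) `^ t).
Proof.
apply: measurableT_comp (measurable_powR t) _.
apply: measurableT_comp (continuous_measurable_fun (@sqrt_continuous R)) _.
apply: measurable_sum => i; apply: measurable_funX.
apply: (eq_measurable_fun (fun y : Rn R n => x ord0 i - y ord0 i)).
  by move=> y _; rewrite !mxE.
apply: measurable_funB => //.
exact: measurable_coord.
Qed.

Lemma measurable_riesz_integrand g x : borel_measurable g ->
  measurable_fun setT (fun y : Rn R n => (g y * enorm (x - y) `^ (- s))%:E).
Proof.
move=> /borel_measurableP mg; apply: measurableT_comp => //.
exact: measurable_funM mg (measurable_kernel _ _).
Qed.

Lemma measurable_indic_cube x r :
  measurable_fun setT (fun y : Rn R n => (\1_(cube x r) y)%:E : \bar R).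
Proof.
apply: measurableT_comp => //; apply: measurable_indic; exact: measurable_cube.
Qed.

Lemma cube_enorm x r (y : Rn R n) : 0 <= r -> cube x r y -> enorm (x - y) <= n%:R * r.
Proof.
by move=> r0 xy; apply: enorm_le_bound => // i; rewrite !mxE ltW// xy.
Qed.

(* On the cube of centre [(1 - th) x] and half-side [th |x| / (2 n)], which lies
   in the ball of radius [|x|] and away from the pole [x], the kernel is at least
   [(2 th |x|)^(alpha - n)]. *)
Lemma riesz_lower (th : R) : 0 < th -> th <= 4^-1 ->
  exists2 k : R, 0 < k & forall g x (m : R), borel_measurable g -> (forall y, 0 <= g y) ->
    0 < enorm x -> 0 <= m ->
    (forall y, enorm y <= enorm x -> enorm x / 2 <= enorm y ->
      enorm (x - y) <= 2 * th * enorm x -> m <= g y) ->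
    ((k * m * enorm x `^ alpha)%:E <= riesz alpha g x)%E.
Proof.
move=> th0 th4; exists ((2 * th) `^ (- s) * (th / n%:R) ^+ n).
  by rewrite mulr_gt0 ?powR_gt0 ?exprn_gt0 ?divr_gt0 ?mulr_gt0.
move=> g x m mg g0 x0 m0 mle.
(* With [n * r = th * N / 2], points of the cube satisfy [th * N / 2 <= |x - y| <= 3 * th * N / 2];
   then [th <= 1/4] gives [|y| >= N / 2]. *)
set N := enorm x in x0 mle *; pose r := th * N / (2 * n%:R).
have r0 : 0 <= r by rewrite divr_ge0 ?mulr_ge0// ltW.
have nr : n%:R * r = th * N / 2 by rewrite /r; field; rewrite gt_eqF.
pose c := (1 - th) *: x.
have cN : enorm c = (1 - th) * N by rewrite enormZ ger0_norm//; lra.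
have xc : enorm (x - c) = th * N.
  rewrite (_ : x - c = th *: x) ?enormZ ?gtr0_norm//.
  by rewrite /c scalerBl scale1r opprB addrC subrK.
have thN : 0 < th * N by rewrite mulr_gt0.
have thN4 : th * N <= 4^-1 * N by rewrite ler_pM2r.
have xy_le y : cube c r y -> enorm (x - y) <= th * N + th * N / 2.
  move=> cy; rewrite -(subrKA c) (le_trans (enormD _ _))// xc lerD2l -nr.
  exact: cube_enorm.
have xy_ge y : cube c r y -> th * N / 2 <= enorm (x - y).
  move=> cy; have := enormB (x - y) (c - y); rewrite opprB addrA subrK xc => le1.
  have := cube_enorm _ _ _ r0 cy; rewrite nr => le2; lra.
have gm y : cube c r y -> m <= g y.
  move=> cy; have le1 := xy_le _ cy; have le2 := cube_enorm _ _ _ r0 cy.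
  rewrite nr in le2; apply: mle; last by rewrite -mulrA; lra.
    have := enormB c (c - y); rewrite opprB addrC subrK cN => le3; lra.
  have := enormD (x - y) y; rewrite subrK -/N => le3; lra.
rewrite rieszE.
have -> : ((2 * th) `^ (- s) * (th / n%:R) ^+ n * m * N `^ alpha)%:E =
    ((m * (2 * th * N) `^ (- s))%:E * ((2 * r) ^+ n)%:E)%E.
  rewrite -EFinM; congr EFin.
  rewrite (_ : 2 * r = th / n%:R * N); last by rewrite /r; field; rewrite gt_eqF.
  rewrite [(2 * th * N) `^ _]powRM ?mulr_ge0 ?(ltW th0) ?(ltW x0)// [(th / n%:R * N) ^+ n]exprMn.
  rewrite -[N ^+ n]powR_mulrn ?(ltW x0)//.
  have -> : N `^ alpha = N `^ (- s) * N `^ n%:R.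
    rewrite -powRD; last by rewrite (gt_eqF x0) implybT.
    by congr (_ `^ _); rewrite /s; ring.
  ring.
rewrite -(intRn_cube c r r0) -intRnZ//; last 2 first.
- exact: measurable_indic_cube.
- by rewrite mulr_ge0 ?powR_ge0.
apply: intRn_le.
- apply: measurable_funeM; exact: measurable_indic_cube.
- exact: measurable_riesz_integrand.
- by move=> y; rewrite -EFinM lee_fin !mulr_ge0 ?powR_ge0.
move=> y; rewrite -EFinM lee_fin indicE.
have [cy|cy] := pselect (cube c r y); last first.
  by rewrite memNset// mulr0 mulr_ge0 ?powR_ge0.
rewrite mem_set// mulr1 ler_pM ?powR_ge0 ?gm//.
have := xy_ge _ cy; have := xy_le _ cy => le1 le2.
by apply: powRN_le; [lra|rewrite -mulrA; lra|exact: ltW].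
Qed.

(** The cube of half-side [1/n] lies in the unit ball, where the kernel is at least [(2 |x|)^-s];
    what remains is the positive mass of [g] on that cube. *)
Lemma riesz_far g : borel_measurable g -> (forall y, 0 < g y) ->
  exists2 c : R, 0 < c & forall x, 1 < enorm x ->
    ((c / enorm x `^ s)%:E <= riesz alpha g x)%E.
Proof.
move=> mg g0; pose W (y : Rn R n) : \bar R := ((g y)%:E * (\1_(cube 0 n%:R^-1) y)%:E)%E.
have mgE : measurable_fun setT (fun y : Rn R n => (g y)%:E).
  by apply: measurableT_comp => //; exact/borel_measurableP.
have mW : measurable_fun setT W.
  apply: emeasurable_funM => //; exact: measurable_indic_cube.
have W0 y : (0 <= W y)%E by rewrite /W -EFinM lee_fin mulr_ge0// ltW.
have n1 : 0 <= n%:R^-1 :> R by rewrite invr_ge0.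
have Wgt0 : (0 < intRn W)%E.
  rewrite lt_neqAle intRn_ge0// andbT; apply/eqP => /esym IW.
  have : intRn (fun y : Rn R n => (\1_(cube 0 n%:R^-1) y)%:E) = 0%E :> \bar R.
    apply: intRn_eq0 IW => //; first exact: measurable_indic_cube.
    by move=> y; rewrite /W -EFinM => -[] /eqP; rewrite mulf_eq0 gt_eqF//= => /eqP ->.
  rewrite intRn_cube// => -[] /eqP; apply/negP.
  by rewrite gt_eqF// exprn_gt0// mulr_gt0// invr_gt0.
(* The mass might be infinite, so a positive real below it is chosen. *)
have [c c0 cW] : exists2 c : R, 0 < c & (c%:E <= intRn W)%E.
  move: Wgt0; case: (intRn W) => [r||]//.
    by rewrite lte_fin => r0; exists r.
  by move=> _; exists 1 => //; rewrite leey.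
exists (2 `^ (- s) * c); first by rewrite mulr_gt0// powR_gt0.
move=> x x1; have x0 : 0 < enorm x by exact: lt_trans x1.
have -> : ((2 `^ (- s) * c / enorm x `^ s)%:E = ((2 * enorm x) `^ (- s))%:E * c%:E)%E.
  by rewrite -EFinM -powRN powRM ?(ltW x0)//; congr EFin; ring.
have k0 : 0 <= (2 * enorm x) `^ (- s) by exact: powR_ge0.
apply: le_trans (lee_wpmul2l _ cW) _; first by rewrite lee_fin.
rewrite -intRnZ// rieszE; apply: intRn_le.
- exact: measurable_funeM.
- by apply: measurable_riesz_integrand.
- by move=> y; rewrite mule_ge0.
move=> y; rewrite /W -!EFinM lee_fin indicE.
have [cy|cy] := pselect (cube 0 n%:R^-1 y); last first.
  by rewrite memNset// !mulr0 mulr_ge0 ?powR_ge0 ?(ltW (g0 _)).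
rewrite mem_set// mulr1 mulrC ler_wpM2l ?(ltW (g0 _))//.
have := cube_enorm _ _ _ n1 cy; rewrite sub0r enormN divff ?gt_eqF// => y1.
apply: powRN_le; last exact: ltW.
  have := enormD (x - y) y; rewrite subrK => le1; lra.
have := enormB x y => le1; lra.
Qed.

(* Dyadic decomposition: off its centre, the cube of half-side [r] is covered by
   the shells between the cubes of half-sides [r / 2 ^ k] and [r / 2 ^ (k + 1)]. *)
Lemma intRn_cube_kernel : exists2 C : R, 0 < C & forall x r, 0 < r ->
  (intRn (fun y => (\1_(cube x r) y * enorm (x - y) `^ (- s))%:E)
    <= (C * r `^ alpha)%:E)%E.
Proof.
pose h : R := 2^-1; pose q := h `^ alpha.
have h0 : 0 < h by rewrite invr_gt0.
have q1 : q < 1.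
  have h1 : h < 1 by rewrite /h; lra.
  have : h `^ alpha < 1 `^ alpha by apply: gt0_ltr_powR; rewrite ?nnegrE ?ltW.
  by rewrite powR1.
have q0 : 0 < q by exact: powR_gt0.
(* [F k] below bounds the kernel by its value at the inner half-side [r * h ^+ k.+1], but integrates
   over the full outer cube of half-side [r * h ^+ k]. The mismatch of one index costs [h ^ (- s)],
   and the integrals form a geometric series of ratio [q]. *)
pose A := h `^ (- s) * 2 ^+ n.
have A0 : 0 < A by rewrite mulr_gt0 ?powR_gt0 ?exprn_gt0.
exists (A / (1 - q)); first by rewrite divr_gt0// subr_gt0.
move=> x r r0.
pose a k := (r * h ^+ k.+1) `^ (- s).
have a0 k : 0 <= a k by exact: powR_ge0.
pose F k (y : Rn R n) := ((a k)%:E * (\1_(cube x (r * h ^+ k)) y)%:E)%E.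
have mF k : measurable_fun setT (F k).
  apply: measurable_funeM; exact: measurable_indic_cube.
have F0 k y : (0 <= F k y)%E by rewrite /F -EFinM lee_fin mulr_ge0.
apply: (@le_trans _ _ (intRn (fun y : Rn R n => \sum_(0 <= k <oo) F k y)%E)).
  apply: intRn_le.
  - apply: measurableT_comp => //; apply: measurable_funM.
      by apply: measurable_indic; exact: measurable_cube.
    exact: measurable_kernel.
  - exact: ge0_emeasurable_sum.
  - by move=> y; rewrite lee_fin mulr_ge0 ?powR_ge0.
  move=> y; have [xy|xy] := pselect (cube x r y); last first.
    by rewrite indicE memNset// mul0r; exact: nneseries_ge0.
  (* At the pole the kernel takes the default value [0 ^ (- s) = 0], so the centre needs no
     shell. *)
  have [->|yx] := eqVneq (y : 'rV_n) x.
    rewrite subrr (_ : enorm 0 = 0); last by apply/eqP; rewrite enorm_eq0.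
    rewrite powR0 ?oppr_eq0 ?(gt_eqF s_gt0)// mulr0.
    exact: nneseries_ge0.
  have [i xyi] : exists i, x ord0 i != y ord0 i.
    apply/existsP; apply: contraNT yx; rewrite negb_exists => /forallP xy'.
    by apply/eqP/rowP => i; have := xy' i; rewrite negbK => /eqP.
  have xyi0 : 0 < `|x ord0 i - y ord0 i| by rewrite normr_gt0 subr_eq0.
  have [k] : exists k, ~~ `[< cube x (r * h ^+ k.+1) y >].
    have [k hk] : exists k : nat, h ^+ k.+1 < `|x ord0 i - y ord0 i| / r.
      have [k hk] : exists k : nat, `|r / `|x ord0 i - y ord0 i| | < k.+1%:R.
        exists (Num.bound (r / `|x ord0 i - y ord0 i|)).
        apply: lt_trans (_ : (Num.bound (r / `|x ord0 i - y ord0 i|))%:R < _); last by rewrite ltr_nat.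
        by rewrite ger0_norm ?archi_boundP// divr_ge0// ltW.
      exists k; rewrite -[ltRHS]invf_div exprVn ltf_pV2 ?posrE ?divr_gt0 ?exprn_gt0//.
      rewrite ger0_norm in hk; last by rewrite divr_ge0// ltW.
      by rewrite (lt_trans hk)// -natrX ltr_nat ltn_expl.
    exists k; apply/asboolPn => /(_ i); apply/negP; rewrite -leNgt.
    by rewrite mulrC -ler_pdivlMr// ltW.
  pose P k := ~~ `[< cube x (r * h ^+ k.+1) y >].
  rewrite -/(P k) => Pk; have exP : exists k, P k by exists k.
  (* The least [m] with [y] outside cube [m + 1] puts [y] inside cube [m]; the single term [F m]
     then dominates the kernel at [y]. *)
  case: (ex_minnP exP) => m Pm mmin {k Pk exP}.
  have xym : cube x (r * h ^+ m) y.
    case: m Pm mmin => [|m] Pm mmin; first by rewrite expr0 mulr1.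
    apply: contrapT => nxy; have := mmin m; rewrite ltnn => Pm0.
    by have /Pm0 : P m by exact/asboolPn.
  apply: le_trans (nneseries_lim_ge m.+1 _) => //.
  rewrite big_nat_recr//= -[leLHS]add0e leeD//; first exact: sume_ge0.
  rewrite /F -EFinM lee_fin !indicE !mem_set// mul1r mulr1.
  have : exists j, r * h ^+ m.+1 <= `|x ord0 j - y ord0 j|.
    apply: contrapT => /forallNP nxy; move/asboolPn : Pm; apply => j.
    by rewrite ltNge; apply/negP; exact: nxy.
  move=> [j xyj]; apply: powRN_le; [|apply: le_trans xyj _|exact: ltW].
    by rewrite mulr_gt0// exprn_gt0.
  by have := enorm_coord (x - y) j; rewrite !mxE.
rewrite intRn_nneseries//.
have IF k : intRn (F k) = (A * r `^ alpha * q ^+ k)%:E.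
  rewrite intRnZ//; last exact: measurable_indic_cube.
  rewrite intRn_cube ?mulr_ge0 ?exprn_ge0 ?(ltW r0) ?(ltW h0)// -EFinM; congr EFin.
  have hX t j : (h ^+ j) `^ t = (h `^ t) ^+ j.
    by rewrite -(powR_mulrn j (ltW h0)) -(powR_mulrn j (powR_ge0 h t)) powRAC.
  rewrite /a powRM ?exprn_ge0 ?(ltW r0) ?(ltW h0)// hX exprS.
  rewrite !exprMn -exprM mulnC exprM.
  have split t : 0 < t -> t `^ alpha = t `^ (- s) * t ^+ n.
    move=> t0; rewrite -powR_mulrn ?(ltW t0)// -powRD; last by rewrite (gt_eqF t0) implybT.
    by congr (_ `^ _); rewrite /s; ring.
  rewrite /q !split// exprMn /A; ring.
rewrite (eq_eseriesr (fun k _ => IF k)).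
apply: lime_le.
  apply: is_cvg_nneseries => k _ _; rewrite lee_fin.
  by rewrite !mulr_ge0 ?exprn_ge0 ?powR_ge0 ?(ltW A0) ?(ltW q0).
apply: nearW => m; rewrite sumEFin lee_fin -mulr_sumr.
rewrite [leLHS]mulrAC ler_wpM2r ?powR_ge0// ler_wpM2l ?(ltW A0)//.
rewrite -[leRHS]mul1r ler_pdivlMr ?subr_gt0// big_mkord.
have := subrX1 q m => qm; have qm0 : 0 <= q ^+ m by rewrite exprn_ge0// ltW.
have : (\sum_(i < m) q ^+ i) * (1 - q) = 1 - q ^+ m.
  by rewrite -[RHS]opprB qm; ring.
by move=> ->; lra.
Qed.

(** On a cube about [x], [g <= N] and the kernel integral give the error term. Off the cube
    [|z - y| <= 2 |x - y|], so the two kernels compare with constant [2 ^ s]. *)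
Lemma riesz_harnack : exists C D : R, [/\ 0 < C, 0 < D &
  forall g x z (N : R), borel_measurable g -> (forall y, 0 <= g y) -> 0 < enorm x -> 0 <= N ->
    (forall y, enorm (x - y) <= enorm x / 2 -> g y <= N) ->
    enorm (x - z) <= enorm x / (4 * n%:R) ->
    (riesz alpha g x <= C%:E * riesz alpha g z + (D * N * enorm x `^ alpha)%:E)%E].
Proof.
have [D D0 kD] := intRn_cube_kernel.
exists (2 `^ s), D; split=> //.
move=> g x z N mg g0 x0 N0 gN xz.
pose r := enorm x / (2 * n%:R).
have r0 : 0 < r by rewrite divr_gt0 ?mulr_gt0.
have nr : n%:R * r = enorm x / 2 by rewrite /r; field; rewrite gt_eqF.
have rx : r <= enorm x.
  rewrite ler_pdivrMr ?mulr_gt0// -[leLHS]mulr1 ler_wpM2l ?(ltW x0)//.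
  by rewrite -natrM ler1n muln_gt0.
have xz2 : enorm (x - z) <= r / 2.
  by apply: le_trans xz _; rewrite le_eqVlt; apply/orP; left; apply/eqP; rewrite /r; field; rewrite gt_eqF.
have C0 : 0 <= 2 `^ s :> R by exact: powR_ge0.
pose G (y : Rn R n) := (\1_(cube x r) y * enorm (x - y) `^ (- s))%:E.
have mG : measurable_fun setT G.
  apply: measurableT_comp => //; apply: measurable_funM.
    by apply: measurable_indic; exact: measurable_cube.
  exact: measurable_kernel.
have G0 y : (0 <= G y)%E by rewrite lee_fin mulr_ge0 ?powR_ge0.
pose F w (y : Rn R n) := (g y * enorm (w - y) `^ (- s))%:E.
have F0 w y : (0 <= F w y)%E by rewrite lee_fin mulr_ge0 ?powR_ge0.
have mF w : measurable_fun setT (F w) by exact: measurable_riesz_integrand.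
have leG : (N%:E * intRn G <= (D * N * enorm x `^ alpha)%:E)%E.
  have -> : ((D * N * enorm x `^ alpha)%:E = N%:E * (D * enorm x `^ alpha)%:E)%E.
    by rewrite -EFinM; congr EFin; ring.
  rewrite lee_wpmul2l ?lee_fin//; apply: le_trans (kD x r r0) _.
  rewrite lee_fin ler_wpM2l ?(ltW D0)//.
  by apply: ge0_ler_powR; rewrite ?nnegrE ?(ltW alpha_gt0) ?(ltW r0) ?(ltW x0).
rewrite !rieszE; apply: le_trans (leeD2l _ leG).
have mCF : measurable_fun setT (fun y => (2 `^ s)%:E * F z y)%E.
  exact: measurable_funeM (mF z).
have mNG : measurable_fun setT (fun y => N%:E * G y)%E by exact: measurable_funeM.
have CF0 y : (0 <= (2 `^ s)%:E * F z y)%E by apply: mule_ge0 (F0 z y); rewrite lee_fin.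
have NG0 y : (0 <= N%:E * G y)%E by apply: mule_ge0 (G0 y); rewrite lee_fin.
rewrite -/(F x) -/(F z) -(intRnZ _ _ (mF z) (F0 z) C0) -(intRnZ _ _ mG G0 N0).
rewrite -(intRnD _ _ mCF mNG CF0 NG0).
apply: (intRn_le _ _ (mF x) _ (F0 x)); first exact: emeasurable_funD mCF mNG.
move=> y; rewrite /F /G -!EFinM -EFinD lee_fin indicE.
have [xy|xy] := pselect (cube x r y).
  rewrite mem_set// mul1r ler_wpDl ?mulr_ge0 ?powR_ge0//.
  rewrite ler_wpM2r ?powR_ge0// gN// -nr.
  by apply: cube_enorm => //; exact: ltW.
rewrite memNset// mul0r mulr0 addr0 mulrCA ler_wpM2l//.
have rxy : r <= enorm (x - y).
  rewrite leNgt; apply/negP => xyr; apply: xy => i.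
  by apply: le_lt_trans xyr; have := enorm_coord (x - y) i; rewrite !mxE.
(* Needed because the kernel is 0 at its pole: the comparison would fail at [y = z]. *)
have zy_gt0 : 0 < enorm (z - y).
  have := enormD (x - z) (z - y); rewrite addrA subrK => le1; lra.
have zy_le : enorm (z - y) <= 2 * enorm (x - y).
  have := enormD (z - x) (x - y); rewrite addrA subrK (enormBC z x) => le1; lra.
have xy_gt0 : 0 < enorm (x - y) by exact: lt_le_trans rxy.
have := powRN_le _ _ s zy_gt0 zy_le (ltW s_gt0).
rewrite powRM ?(ltW xy_gt0)// [2 `^ _]powRN => le1.
rewrite -(ler_pM2l (_ : 0 < (2 `^ s)^-1)) ?invr_gt0 ?powR_gt0//.
by rewrite mulKf ?gt_eqF ?powR_gt0.
Qed.

End RieszPotential.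

(** * Decay of both components when one is almost decreasing *)

Section System.
Context {R : realType} {n : nat} {alpha : R}.
Hypothesis n_gt0 : (0 < n)%N.
Hypothesis alpha_gt0 : 0 < alpha.
Hypothesis alpha_lt : alpha < n%:R.
Implicit Types (u v : 'rV[R]_n -> R) (p q : R).

Lemma borel_measurable_powR u p :
  borel_measurable u -> borel_measurable (fun y => u y `^ p).
Proof.
move=> /borel_measurableP mu; apply/borel_measurableP.
exact: measurableT_comp (measurable_powR p) mu.
Qed.

(** No order between [p] and [q] is assumed, so exchanging [(u, p)] with [(v, q)] covers the case of
    almost decreasing [v]. *)
Lemma decay_of_almost_monotone u v p q eps :
  0 < p -> 0 < q -> 1 < p * q ->
  borel_measurable u -> borel_measurable v ->
  (forall x, 0 < u x) -> (forall x, 0 < v x) ->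
  (forall x, (u x)%:E = riesz alpha (fun y => v y `^ q) x) ->
  (forall x, (v x)%:E = riesz alpha (fun y => u y `^ p) x) ->
  0 < eps -> (forall x y, enorm y <= enorm x -> eps * u x <= u y) ->
  exists2 C : R, 0 < C & forall x, 0 < enorm x ->
    u x <= C * enorm x `^ (- (alpha * (q + 1) / (p * q - 1))) /\
    v x <= C * enorm x `^ (- (alpha * (p + 1) / (p * q - 1))).
Proof.
move=> p0 q0 pq1 mu mv u0 v0 uE vE eps0 umon.
have mup := borel_measurable_powR _ p mu; have mvq := borel_measurable_powR _ q mv.
set a := alpha * (q + 1) / (p * q - 1); set b := alpha * (p + 1) / (p * q - 1).
have e0 : 0 < p * q - 1 by lra.
have a_gt0 : 0 < a by rewrite divr_gt0// mulr_gt0//; lra.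
have bE : a * p - alpha = b by rewrite /a /b; field; rewrite gt_eqF.
have qbE : q * b = alpha + a by rewrite /a /b; field; rewrite gt_eqF.
have q40 : 0 < 4^-1 :> R by rewrite invr_gt0.
have [k k0 lower] := riesz_lower n_gt0 alpha_lt _ q40 (lexx _).
have vlow x : 0 < enorm x -> k * (eps * u x) `^ p * enorm x `^ alpha <= v x.
  move=> x0; rewrite -lee_fin vE; apply: lower => // [y||y yx _ _]; [exact: powR_ge0|exact: powR_ge0|].
  apply: powR_le_base (umon _ _ yx); first exact: ltW.
  by rewrite mulr_ge0// ltW.
(* One [eps] comes from [vlow] at [y], the other from comparing [u y] with [u x]; the factor
   [2^-1 ^ alpha] comes from [|y| >= |x| / 2]. *)
pose k1 := k * (eps * eps) `^ p * 2^-1 `^ alpha.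
have k1_gt0 : 0 < k1 by rewrite !mulr_gt0 ?powR_gt0 ?mulr_gt0 ?invr_gt0.
have ulow x : 0 < enorm x ->
    k * (k1 * u x `^ p * enorm x `^ alpha) `^ q * enorm x `^ alpha <= u x.
  move=> x0; rewrite -lee_fin uE; apply: lower => // [y||y yx xy _]; [exact: powR_ge0|exact: powR_ge0|].
  apply: powR_le_base; first exact: ltW.
    by rewrite mulr_ge0 ?powR_ge0// mulr_ge0 ?powR_ge0// ltW.
  have y0 : 0 < enorm y by lra.
  apply: le_trans (vlow _ y0); rewrite /k1.
  rewrite -[k * _ * _ * u x `^ p]mulrAC -[leLHS]mulrA -powRM ?invr_ge0 ?(ltW x0)//.
  rewrite -[k * _ * u x `^ p]mulrA -powRM ?mulr_ge0 ?(ltW eps0) ?(ltW (u0 _))//.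
  apply: ler_pM; rewrite ?mulr_ge0 ?powR_ge0 ?(ltW k0)//.
    rewrite ler_wpM2l ?(ltW k0)// powR_le_base ?(ltW p0) ?mulr_ge0 ?(ltW eps0) ?(ltW (u0 _))//.
    by rewrite -mulrA ler_wpM2l ?(ltW eps0)// umon.
  by rewrite powR_le_base ?(ltW alpha_gt0) ?mulr_ge0 ?invr_ge0 ?(ltW x0)// mulrC.
move: k1 k1_gt0 ulow => k1 k1_gt0 ulow.
pose k2 := k * k1 `^ q; have k2_gt0 : 0 < k2 by rewrite mulr_gt0 ?powR_gt0.
pose Cu := k2^-1 `^ (p * q - 1)^-1.
have Cu_gt0 : 0 < Cu by rewrite powR_gt0// invr_gt0.
have uup x : 0 < enorm x -> u x <= Cu * enorm x `^ (- a).
  move=> x0; apply: superlinear_bound => //.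
  rewrite subrK; apply: le_trans (ulow _ x0).
  rewrite [in leRHS]powRM ?mulr_ge0 ?powR_ge0 ?(ltW k1_gt0)//.
  rewrite [in leRHS]powRM ?powR_ge0 ?(ltW k1_gt0)// -!powRrM.
  rewrite mulrDr mulr1 powRDr// /k2.
  by rewrite le_eqVlt; apply/orP; left; apply/eqP; ring.
have [C [D [C0 D0 harnack]]] := riesz_harnack n_gt0 alpha_gt0 alpha_lt.
(* With this [th], the radius [2 * th * |x|] in [riesz_lower] equals the Harnack radius
   [|x| / (4 n)]. *)
have th0 : 0 < (8 * n%:R)^-1 :> R by rewrite invr_gt0 mulr_gt0 ?ltr0n.
have th4 : (8 * n%:R)^-1 <= 4^-1 :> R.
  by rewrite lef_pV2 ?posrE ?mulr_gt0 ?ltr0n// -natrM ler_nat (@leq_trans 8)// leq_pmulr.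
have [l l0 lower'] := riesz_lower n_gt0 alpha_lt _ th0 th4.
(* For [|x - y| <= |x| / 2] one has [|y| >= |x| / 2], so the decay of [u] gives
   [u y ^ p <= N0 |x|^(- a p)]; by [bE] the factor [|x|^alpha] turns this into [|x|^-b]. *)
pose N0 := (Cu * 2^-1 `^ (- a)) `^ p; pose D' := D * N0.
have N0_gt0 : 0 < N0 by apply: powR_gt0; rewrite mulr_gt0 ?powR_gt0 ?invr_gt0.
have D'_gt0 : 0 < D' by rewrite mulr_gt0.
have vharnack : forall x z : 'rV[R]_n, 0 < enorm x -> enorm (x - z) <= enorm x / (4 * n%:R) ->
    v x <= C * v z + D' * enorm x `^ (- b).
  move=> x z x0 xz.
  have := harnack (fun y => u y `^ p) x z (N0 * enorm x `^ (- a * p)) mup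
    (fun y => powR_ge0 _ _) x0 _ _ xz.
  rewrite -!vE -EFinM -EFinD lee_fin.
  have -> : D * (N0 * enorm x `^ (- a * p)) * enorm x `^ alpha = D' * enorm x `^ (- b).
    have -> : - b = - a * p + alpha by rewrite -bE; ring.
    by rewrite powRDr// /D'; ring.
  apply; first by rewrite mulr_ge0 ?powR_ge0.
  have Cu2_ge0 := mulr_ge0 (ltW Cu_gt0) (powR_ge0 2^-1 (- a)).
  move=> y xy; rewrite /N0 powRrM -(powRM p Cu2_ge0 (powR_ge0 (enorm x) (- a))).
  apply: powR_le_base; [exact: ltW|exact: ltW|].
  have xy2 : 2^-1 * enorm x <= enorm y.
    have := enormD (x - y) y; rewrite subrK => le1; lra.
  have y0 : 0 < enorm y by apply: lt_le_trans xy2; rewrite mulr_gt0 ?invr_gt0.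
  apply: le_trans (uup _ y0) _.
  rewrite -mulrA ler_wpM2l ?(ltW Cu_gt0)// -powRM ?invr_ge0 ?(ltW x0)//.
  by apply: powRN_le => //; rewrite ?mulr_gt0 ?invr_gt0// ltW.
move: D' D'_gt0 vharnack => D' D'_gt0 vharnack.
pose l1 := l * (2 * C)^-1 `^ q.
have l1_gt0 : 0 < l1 by rewrite mulr_gt0 ?powR_gt0 ?invr_gt0 ?mulr_gt0.
pose Cv := (l1^-1 * Cu) `^ q^-1.
have Cv_ge0 : 0 <= Cv by exact: powR_ge0.
have vup x : 0 < enorm x -> v x <= (2 * D' + Cv) * enorm x `^ (- b).
  move=> x0; have xb0 : 0 < enorm x `^ (- b) by exact: powR_gt0.
  (* In the second case the Harnack error is below [v x / 2], so it can be absorbed: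
     [v z >= v x / (2 C)] for all [z] near [x]. *)
  have [vx|vx] := leP (v x) (2 * D' * enorm x `^ (- b)).
    by apply: le_trans vx _; rewrite ler_wpM2r ?(ltW xb0)// lerDl.
  apply: (@le_trans _ _ (Cv * enorm x `^ (- b))); last first.
    by rewrite ler_wpM2r ?(ltW xb0)// lerDr mulr_ge0 ?(ltW D'_gt0).
  have low : l * ((2 * C)^-1 * v x) `^ q * enorm x `^ alpha <= u x.
    rewrite -lee_fin uE; apply: lower' => // [y||z _ _ xz]; [exact: powR_ge0|exact: powR_ge0|].
    apply: powR_le_base; first exact: ltW.
      by rewrite mulr_ge0 ?invr_ge0 ?(ltW (v0 _))// mulr_ge0 ?(ltW C0).
    rewrite mulrC ler_pdivrMr ?mulr_gt0//.
    have xz' : enorm (x - z) <= enorm x / (4 * n%:R).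
      apply: le_trans xz _; rewrite le_eqVlt; apply/orP; left; apply/eqP.
      by field; rewrite pnatr_eq0 -lt0n.
    have := vharnack _ _ x0 xz'; lra.
  rewrite powRM ?invr_ge0 ?mulr_ge0 ?(ltW C0) ?(ltW (v0 _))// in low.
  (* Compare [low] with the decay of [u]; the exponents match by [qbE]. *)
  have vq : v x `^ q <= l1^-1 * Cu * enorm x `^ (- (b * q)).
    have -> : - (b * q) = - a + - alpha by rewrite mulrC qbE opprD addrC.
    rewrite powRDr// [enorm x `^ (- alpha)]powRN mulrA ler_pdivlMr ?powR_gt0//.
    rewrite -mulrA [leRHS]mulrC ler_pdivlMr//.
    apply: le_trans (uup _ x0); apply: le_trans low.
    by rewrite le_eqVlt /l1; apply/orP; left; apply/eqP; ring.
  have := le_powR_root _ _ _ q0 (ltW (v0 x)) vq.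
  rewrite powRM ?mulr_ge0 ?invr_ge0 ?powR_ge0 ?(ltW l1_gt0) ?(ltW Cu_gt0)//.
  by rewrite -powRrM mulNr mulfK// gt_eqF.
exists (Cu + (2 * D' + Cv)).
  by rewrite ltr_wpDr// addr_ge0// mulr_ge0// ltW.
move=> x x0; split.
  apply: le_trans (uup _ x0) _; rewrite ler_wpM2r ?powR_ge0// lerDl.
  by rewrite addr_ge0// mulr_ge0// ltW.
by apply: le_trans (vup _ x0) _; rewrite ler_wpM2r ?powR_ge0// lerDr ltW.
Qed.

End System.

(** * Lower rates at infinity, and upper rates under almost monotonicity of either component *)

Theorem theorem1p1 (R : realType) (n : nat) (alpha p q : R)
    (u v : 'rV[R]_n -> R) :
  (3 <= n)%N -> 0 < alpha -> alpha < n%:R ->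
  0 < p -> 0 < q -> 1 < p * q -> p <= q ->
  borel_measurable u -> borel_measurable v ->
  (forall x, 0 < u x) -> (forall x, 0 < v x) ->
  (forall x, (u x)%:E = riesz alpha (fun y => v y `^ q) x) ->
  (forall x, (v x)%:E = riesz alpha (fun y => u y `^ p) x) ->
  (exists c : R, 0 < c /\ exists R0 : R, forall x, R0 < enorm x ->
      c / enorm x `^ (n%:R - alpha) <= u x /\
      c / enorm x `^ (Num.min (n%:R - alpha) (p * n%:R - (p + 1) * alpha))
        <= v x)
  /\
  ((exists M : R, forall x, u x <= M /\ v x <= M) ->
   (forall eps : R, 0 < eps -> exists R0 : R, forall x, R0 < enorm x ->
      u x < eps /\ v x < eps) ->
   (exists eps0 : R, 0 < eps0 /\
      ((forall x y, enorm y <= enorm x -> eps0 * u x <= u y) \/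
       (forall x y, enorm y <= enorm x -> eps0 * v x <= v y))) ->
   exists C : R, 0 < C /\ exists R0 : R, forall x, R0 < enorm x ->
      u x <= C * enorm x `^ (- (alpha * (q + 1) / (p * q - 1))) /\
      v x <= C * enorm x `^ (- (alpha * (p + 1) / (p * q - 1)))).
Proof.
move=> n3 alpha0 alphan p0 q0 pq1 _ mu mv u0 v0 uE vE.
have n0 : (0 < n)%N by exact: leq_trans n3.
have s0 : 0 < n%:R - alpha by rewrite subr_gt0.
split; last first.
  move=> _ _ [eps [eps0 [umon|vmon]]].
    have [C C0 CP] := decay_of_almost_monotone n0 alpha0 alphan
      _ _ _ _ _ p0 q0 pq1 mu mv u0 v0 uE vE eps0 umon.
    by exists C; split=> //; exists 0.
  (* The system is symmetric under exchanging [(u, p)] with [(v, q)]. *)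
  rewrite mulrC in pq1 *.
  have [C C0 CP] := decay_of_almost_monotone n0 alpha0 alphan
    _ _ _ _ _ q0 p0 pq1 mv mu v0 u0 vE uE eps0 vmon.
  by exists C; split=> //; exists 0 => x /CP[].
have [cu cu0 cuP] := riesz_far n0 alphan _ (borel_measurable_powR _ q mv)
  (fun y => powR_gt0 q (v0 y)).
have [cv cv0 cvP] := riesz_far n0 alphan _ (borel_measurable_powR _ p mu)
  (fun y => powR_gt0 p (u0 y)).
have q40 : 0 < 4^-1 :> R by rewrite invr_gt0.
have [k k0 lower] := riesz_lower n0 alphan _ q40 (lexx _).
have ulow x : 1 < enorm x -> cu / enorm x `^ (n%:R - alpha) <= u x.
  by move=> x1; rewrite -lee_fin uE; exact: cuP.
(* The threshold 2 ensures [|y| >= |x| / 2 > 1] on the cube near [x], so that [ulow] applies at [y];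
   then [|y| <= |x|] replaces [|y|^-s] by [|x|^-s]. *)
have vlow x : 2 < enorm x ->
    k * cu `^ p / enorm x `^ (p * n%:R - (p + 1) * alpha) <= v x.
  move=> x2; have x0 : 0 < enorm x by lra.
  have -> : k * cu `^ p / enorm x `^ (p * n%:R - (p + 1) * alpha) =
      k * (cu / enorm x `^ (n%:R - alpha)) `^ p * enorm x `^ alpha.
    rewrite -!powRN powRM ?powR_ge0 ?(ltW cu0)// -powRrM -!mulrA -powRDr//.
    by congr (_ * (_ * _ `^ _)); ring.
  rewrite -lee_fin vE; apply: lower => // [|y||y yx xy _];
    [exact: borel_measurable_powR|exact: powR_ge0|exact: powR_ge0|].
  apply: powR_le_base; first exact: ltW.
    by rewrite divr_ge0 ?powR_ge0 ?(ltW cu0).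
  have y1 : 1 < enorm y by lra.
  apply: le_trans (ulow _ y1); rewrite ler_wpM2l ?(ltW cu0)// -!powRN.
  by apply: powRN_le => //; [lra|exact: ltW].
exists (Num.min cu (Num.min cv (k * cu `^ p))); split.
  by rewrite !lt_min cu0 cv0 mulr_gt0 ?powR_gt0.
exists 2 => x x2; have x1 : 1 < enorm x by lra.
have inv0 t : 0 <= (enorm x `^ t)^-1 by rewrite invr_ge0 powR_ge0.
split.
  by apply: le_trans (ulow _ x1); rewrite ler_wpM2r// ge_min lexx.
(* Each value of the minimum has its own bound: the far-field one or [vlow]. *)
case: (leP (n%:R - alpha)) => _.
  apply: (@le_trans _ _ (cv / enorm x `^ (n%:R - alpha))).
    by rewrite ler_wpM2r// !ge_min lexx orbT.
  by rewrite -lee_fin vE; exact: cvP.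
by apply: le_trans (vlow _ x2); rewrite ler_wpM2r// !ge_min lexx !orbT.
Qed.
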